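(* Let $s,m\ge 1$ be integers, $\boldsymbol{M},\boldsymbol{K}\in\mathbb{R}^{m\times m}$, $\boldsymbol{A}\in\mathbb{R}^{s\times s}$ and $\delta t>0$, and suppose that $\boldsymbol{\mathcal{A}}=\boldsymbol{I}_s\otimes\boldsymbol{M}+\delta t\,\boldsymbol{A}\otimes\boldsymbol{K}\in\mathbb{R}^{sm\times sm}$ is nonsingular. Let $\boldsymbol{A}=\boldsymbol{Q}\boldsymbol{R}\boldsymbol{Q}^{T}$ be any real Schur decomposition of $\boldsymbol{A}$, where $\boldsymbol{Q}\in\mathbb{R}^{s\times s}$ is orthogonal and $\boldsymbol{R}\in\mathbb{R}^{s\times s}$ is quasi-triangular (block upper triangular with $1\times 1$ and $2\times 2$ diagonal blocks), and define $$\boldsymbol{\mathcal{M}}_{\text{BRSD}}=(\boldsymbol{Q}\otimes\boldsymbol{I}_m)\,\boldsymbol{\mathcal{R}}\,(\boldsymbol{Q}^{T}\otimes\boldsymbol{I}_m),\qquad \boldsymbol{\mathcal{R}}=\boldsymbol{I}_s\otimes\boldsymbol{M}+\delta t\,\boldsymbol{R}\otimes\boldsymbol{K}.$$ Then $\boldsymbol{\mathcal{M}}_{\text{BRSD}}$ is a mathematically optimal right preconditioner for $\boldsymbol{\mathcal{A}}$.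
   Context: $\otimes$ denotes the Kronecker product and $\boldsymbol{I}_k$ the $k\times k$ identity matrix. Definition. Given $\boldsymbol{\mathcal{A}}\in\mathbb{R}^{n\times n}$ of rank $r$, a matrix $\boldsymbol{\mathcal{G}}$ is an $\epsilon$-accurate right-preconditioning operator for $\boldsymbol{\mathcal{A}}$ if there exists a nonsingular $\boldsymbol{\mathcal{X}}\in\mathbb{C}^{n\times n}$ such that $$\left\Vert \boldsymbol{\mathcal{X}}^{-1}(\boldsymbol{\mathcal{A}}\boldsymbol{\mathcal{G}})\boldsymbol{\mathcal{X}}-\begin{bmatrix}\boldsymbol{I}_r & \boldsymbol{0}\\ \boldsymbol{0}&\boldsymbol{0}\end{bmatrix}\right\Vert=\epsilon<1 .$$ It is mathematically optimal if $\epsilon=0$. A nonsingular matrix $\boldsymbol{\mathcal{M}}$ is called a mathematically optimal right preconditioner for $\boldsymbol{\mathcal{A}}$ if $\boldsymbol{\mathcal{G}}=\boldsymbol{\mathcal{M}}^{-1}$ is mathematically optimal in this sense; for nonsingular $\boldsymbol{\mathcal{A}}$ this is equivalent to $\boldsymbol{\mathcal{A}}\boldsymbol{\mathcal{M}}^{-1}=\boldsymbol{I}$. *)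

(* Defs.v *)
From mathcomp Require Import all_boot all_order all_algebra.
From mathcomp Require Import reals.
From mathcomp Require Export complex mxtens.

Set Implicit Arguments.
Unset Strict Implicit.
Unset Printing Implicit Defensive.

Import Order.TTheory GRing.Theory Num.Theory.
Local Open Scope ring_scope.
Local Open Scope complex_scope.

Section MatrixNorm.
Variables (R : realType) (n : nat).

(* Norm of the complex vector space 'M[R[i]]_n; nonnegativity follows from the
   three clauses, and submultiplicativity is not required. *)
Definition is_matrix_norm (nu : 'M[R[i]]_n -> R) : Prop :=
  [/\ forall X, nu X = 0 -> X = 0,
      forall (a : R[i]) X, nu (a *: X) = ComplexField.Normc.normc a * nu X &
      forall X Y, nu (X + Y) <= nu X + nu Y].

End MatrixNorm.

Section Preconditioning.
Variables (R : realType) (n : nat).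

Definition cplx_mx (A : 'M[R]_n) : 'M[R[i]]_n := map_mx (real_complex R) A.

Definition right_preconditioning_op (nu : 'M[R[i]]_n -> R) (eps : R)
    (A G : 'M[R]_n) : Prop :=
  exists2 X : 'M[R[i]]_n, X \in unitmx &
    nu (invmx X *m cplx_mx (A *m G) *m X - pid_mx (\rank A)) = eps /\ eps < 1.

Definition optimal_right_preconditioning_op (nu : 'M[R[i]]_n -> R)
    (A G : 'M[R]_n) : Prop :=
  right_preconditioning_op nu 0 A G.

Definition optimal_right_preconditioner (nu : 'M[R[i]]_n -> R)
    (A M : 'M[R]_n) : Prop :=
  M \in unitmx /\ optimal_right_preconditioning_op nu A (invmx M).

End Preconditioning.

Section RealSchur.
Variables (R : realType) (s : nat).

Definition orthogonal_mx (Q : 'M[R]_s) : Prop := Q^T *m Q = 1%:M.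

(* [d] lists the sizes of the successive diagonal blocks, and
   [reshape_index d i] is the number of the block containing index [i]. *)
Definition quasi_triangular_mx (T : 'M[R]_s) : Prop :=
  exists d : seq nat,
    [/\ all [pred k | (k == 1)%N || (k == 2)%N] d,
        sumn d = s &
        forall i j : 'I_s,
          (reshape_index d j < reshape_index d i)%N -> T i j = 0].

Definition real_Schur (A Q T : 'M[R]_s) : Prop :=
  [/\ orthogonal_mx Q, quasi_triangular_mx T & A = Q *m T *m Q^T].

End RealSchur.

Section Brsd.
Variables (R : realType) (s m : nat).

(* [tensmx A B] is the Kronecker product: for B of size p x q, its entry
   (i * p + k, j * q + l) is A i j * B k l. *)
Definition stage_mx (M K : 'M[R]_m) (dt : R) (A : 'M[R]_s) : 'M[R]_(s * m) :=
  tensmx (1%:M : 'M[R]_s) M + dt *: tensmx A K.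

Definition brsd_mx (M K : 'M[R]_m) (dt : R) (Q T : 'M[R]_s) : 'M[R]_(s * m) :=
  tensmx Q (1%:M : 'M[R]_m) *m stage_mx M K dt T
    *m tensmx Q^T (1%:M : 'M[R]_m).

End Brsd.

(* Main.v *)
(* Since Q is orthogonal, conjugating I (x) M + dt T (x) K by Q (x) I gives back
   I (x) M + dt (Q T Q^T) (x) K: the preconditioner is the matrix itself. *)
Require Import Defs.
From mathcomp Require Import all_boot all_order all_algebra.
From mathcomp Require Import reals.
Import Order.TTheory GRing.Theory Num.Theory.
Local Open Scope ring_scope.
Local Open Scope complex_scope.

(** By [brsd_mx_real_Schur] the preconditioner equals the nonsingular matrix it preconditions, so
    the preconditioned matrix is the identity; by [optimal_right_preconditioner_refl] this is
    optimal for every norm [nu]. *)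

Lemma brsd_mx_real_Schur (R : realType) (s m : nat) (M K : 'M[R]_m)
    (A Q T : 'M[R]_s) (dt : R) :
  real_Schur A Q T -> brsd_mx M K dt Q T = stage_mx M K dt A.
Proof.
move=> [QtQ _ ->]; rewrite /brsd_mx /stage_mx mulmxDr mulmxDl.
rewrite -scalemxAr -scalemxAl !tensmx_mul !mulmx1 !mul1mx.
(* The mixed-product rule leaves [Q *m Q^T] in the [M] term; a one-sided inverse of a square matrix
   is two-sided. *)
by rewrite (mulmx1C QtQ).
Qed.

Lemma is_matrix_norm0 (R : realType) (n : nat) (nu : 'M[R[i]]_n -> R) :
  is_matrix_norm nu -> nu 0 = 0.
Proof.
by case=> _ nuZ _; rewrite -(scale0r 0) nuZ ComplexField.Normc.normc0 mul0r.
Qed.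

Lemma optimal_right_preconditioner_refl (R : realType) (n : nat)
    (nu : 'M[R[i]]_n -> R) (A : 'M[R]_n) :
  is_matrix_norm nu -> A \in unitmx -> optimal_right_preconditioner nu A A.
Proof.
move=> hnu uA; split=> //; exists 1%:M; first exact: unitmx1.
(* Full rank turns the target [pid_mx] into the identity, so [X = 1] gives a zero difference. *)
rewrite mulmxV // /cplx_mx map_mx1 invmx1 !mulmx1 mxrank_unit // pid_mx_1.
by rewrite subrr is_matrix_norm0 // ltr01.
Qed.

Theorem proposition3p6 (R : realType) (s m : nat)
    (nu : 'M[R[i]]_(s * m) -> R) (M K : 'M[R]_m) (A Q T : 'M[R]_s) (dt : R)
    (hs : (1 <= s)%N) (hm : (1 <= m)%N)
    (hnu : is_matrix_norm nu)
    (hdt : 0 < dt)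
    (hA : stage_mx M K dt A \in unitmx)
    (hQT : real_Schur A Q T) :
  optimal_right_preconditioner nu (stage_mx M K dt A) (brsd_mx M K dt Q T).
Proof.
rewrite (brsd_mx_real_Schur _ _ _ _ _ _ _ _ _ hQT).
exact: optimal_right_preconditioner_refl.
Qed.
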